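(* Let $d\ge1$, $V>0$, $\mathbf x_1,\dots,\mathbf x_n\in[0,1]^d$ and $\mathbf y=(y_1,\dots,y_n)\in\mathbb R^n$. Let $\mathbf A$ be the $n\times p$ design matrix and $\mathbf z_1=\mathbf 0,\mathbf z_2,\dots,\mathbf z_p\in[0,1]^d$ the associated points described in the context. Let $\hat{\boldsymbol\beta}=(\hat\beta_1,\dots,\hat\beta_p)$ be any solution of the LASSO problem $$\hat{\boldsymbol\beta}\in\operatorname*{arg\,min}_{\boldsymbol\beta\in\mathbb R^p:\ \sum_{j\ge2}|\beta_j|\le V}\|\mathbf y-\mathbf A\boldsymbol\beta\|^2 .$$ Then the function $$\hat f:=\sum_{j=1}^p\hat\beta_j\,\mathbb I_{[\mathbf z_j,\mathbf 1]}$$ is a solution of the optimization problem $$\operatorname*{arg\,min}_{f:[0,1]^d\to\mathbb R,\ V_{\mathrm{HK}\mathbf 0}(f)\le V}\frac1n\sum_{i=1}^n(y_i-f(\mathbf x_i))^2 .$$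
   Context: Notation: $\mathbf 0=(0,\dots,0)$, $\mathbf 1=(1,\dots,1)$; $\mathbf a\preceq\mathbf b$ means $a_j\le b_j$ for all $j$; for $\mathbf a\preceq\mathbf b$, $[\mathbf a,\mathbf b]=\prod_j[a_j,b_j]$; $\mathbb I_A$ is the indicator function of $A$; $\|\cdot\|$ is the Euclidean norm. Quasi-volume: for $f:[0,1]^d\to\mathbb R$ and distinct $\mathbf a\preceq\mathbf b$ in $[0,1]^d$, $$\Delta(f;[\mathbf a,\mathbf b])=\sum_{j_1=0}^{J_1}\cdots\sum_{j_d=0}^{J_d}(-1)^{j_1+\dots+j_d}f(b_1+j_1(a_1-b_1),\dots,b_d+j_d(a_d-b_d)),$$ where $J_i=1$ if $a_i\ne b_i$ and $J_i=0$ otherwise. Vitali variation: given univariate partitions $0=x^{(s)}_0<\dots<x^{(s)}_{k_s}=1$, $s=1,\dots,d$, the split they generate is the collection $\mathcal P$ of all rectangles $\prod_{s=1}^d[x^{(s)}_{l_s},x^{(s)}_{l_s+1}]$, $0\le l_s\le k_s-1$. Set $V^{(d)}(f;[0,1]^d)=\sup_{\mathcal P}\sum_{A\in\mathcal P}|\Delta(f;A)|$, supremum over all such splits. HK$\mathbf 0$ variation: for nonempty $S\subseteq\{1,\dots,d\}$ let $f_S:[0,1]^{|S|}\to\mathbb R$ be the restriction of $f$ to $\{\mathbf u\in[0,1]^d:u_j=0\ \forall j\notin S\}$, viewed as a function of the coordinates in $S$. Then $V_{\mathrm{HK}\mathbf 0}(f)=\sum_{\varnothing\ne S\subseteq\{1,\dots,d\}}V^{(|S|)}(f_S;[0,1]^{|S|})$.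 Design matrix: for $\mathbf z\in[0,1]^d$ let $\mathbf v(\mathbf z)=(\mathbb I_{[\mathbf z,\mathbf 1]}(\mathbf x_1),\dots,\mathbb I_{[\mathbf z,\mathbf 1]}(\mathbf x_n))\in\{0,1\}^n$, and let $\mathcal Q=\{\mathbf v(\mathbf z):\mathbf z\in[0,1]^d\}$, a finite set, with $p=|\mathcal Q|$. $\mathbf A$ is the $n\times p$ matrix whose columns are the distinct elements of $\mathcal Q$, ordered so that the first column is $\mathbf v(\mathbf 0)=(1,\dots,1)$. Distinct points $\mathbf z_1,\dots,\mathbf z_p\in[0,1]^d$ with $\mathbf z_1=\mathbf 0$ are fixed so that the $j$-th column of $\mathbf A$ is $\mathbf v(\mathbf z_j)$ for each $j$. *)

(* Defs.v *)
From HB Require Import structures.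
From mathcomp Require Import all_boot all_order all_algebra.
From mathcomp Require Import all_classical all_reals all_analysis.

Set Implicit Arguments.
Unset Strict Implicit.
Unset Printing Implicit Defensive.

Import Order.TTheory GRing.Theory Num.Theory.

Local Open Scope classical_set_scope.
Local Open Scope ring_scope.

(* The coordinates of a point are indexed by an arbitrary finite type I, so that
   [0,1]^d is the case I = 'I_d and [0,1]^|S| the case I = {j | j \in S}.
   0 and 1 of type I -> R are the constant functions.
   A function on [0,1]^I is represented by a total function on I -> R; nothing
   below depends on its values outside the cube. *)

Definition box (R : realType) (I : finType) (a b : I -> R) : set (I -> R) :=
  [set u | forall i, a i <= u i <= b i].

Definition cube (R : realType) (I : finType) : set (I -> R) := box 0 1.
Arguments cube : clear implicits.

Definition quasi_volume (R : realType) (I : finType) (f : (I -> R) -> R)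
    (a b : I -> R) : R :=
  \sum_(e : {ffun I -> 'I_2} | [forall i, (e i <= (a i != b i))%N])
    (-1) ^+ (\sum_i e i)%N * f (fun i => b i + (e i)%:R * (a i - b i)).

(* The points of the s-th univariate partition are those of 0 :: P s. *)
Definition is_split (R : realType) (I : finType) (P : I -> seq R) : Prop :=
  forall s, itv_partition 0 1 (P s).

Definition cell_lo (R : realType) (I : finType) (P : I -> seq R)
    (l : {dffun forall s : I, 'I_(size (P s))}) : I -> R :=
  fun s => nth 0 (0 :: P s) (l s).

Definition cell_hi (R : realType) (I : finType) (P : I -> seq R)
    (l : {dffun forall s : I, 'I_(size (P s))}) : I -> R :=
  fun s => nth 0 (0 :: P s) (l s).+1.

Definition split_variation (R : realType) (I : finType) (f : (I -> R) -> R)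
    (P : I -> seq R) : R :=
  \sum_(l : {dffun forall s : I, 'I_(size (P s))})
    `|quasi_volume f (cell_lo l) (cell_hi l)|.

Definition vitali_variation (R : realType) (I : finType) (f : (I -> R) -> R) :
    \bar R :=
  ereal_sup [set (split_variation f P)%:E | P in [set P | is_split P]].

Definition extend0 (R : realType) (I : finType) (S : {set I})
    (u : {j : I | j \in S} -> R) : I -> R :=
  fun j => if insub j is Some k then u k else 0.

Definition restrict0 (R : realType) (I : finType) (S : {set I})
    (f : (I -> R) -> R) : ({j : I | j \in S} -> R) -> R :=
  fun u => f (extend0 u).

Definition HK0_variation (R : realType) (d : nat) (f : ('I_d -> R) -> R) :
    \bar R :=
  (\sum_(S : {set 'I_d} | S != finset.set0) vitali_variation (restrict0 (S := S) f))%E.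

Definition design_col (R : realType) (d n : nat) (x : 'I_n -> 'I_d -> R)
    (z : 'I_d -> R) : 'cV[R]_n :=
  \col_i \1_(box z 1) (x i).

Definition design_cols (R : realType) (d n : nat) (x : 'I_n -> 'I_d -> R) :
    set 'cV[R]_n :=
  [set design_col x z | z in cube R 'I_d].

(* Since the set of columns is never empty, its cardinality is written p.+1;
   the bijection between column indices and design_cols forces this value. *)
Record is_design (R : realType) (d n p : nat) (x : 'I_n -> 'I_d -> R)
    (A : 'M[R]_(n, p.+1)) (z : 'I_p.+1 -> 'I_d -> R) : Prop := IsDesign {
  design_bij : set_bij [set: 'I_p.+1] (design_cols x) (fun j => col j A);
  design_first : col ord0 A = design_col x 0;
  design_pt_cube : forall j, cube R 'I_d (z j);
  design_pt_inj : injective z;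
  design_pt_first : z ord0 = 0;
  design_pt_col : forall j, col j A = design_col x (z j)
}.

Definition is_argmin (R : realType) (T : Type) (C : set T) (g : T -> R) (t : T) :
    Prop :=
  C t /\ forall t', C t' -> g t <= g t'.

(* The library's norm on matrices is the sup norm. *)
Definition euclidean_norm (R : realType) (n : nat) (v : 'cV[R]_n) : R :=
  Num.sqrt (\sum_i v i ord0 ^+ 2).

(* Main.v *)
Require Import Defs.
From HB Require Import structures.
From mathcomp Require Import all_boot all_order all_algebra.
From mathcomp Require Import all_classical all_reals all_analysis.

Set Implicit Arguments.
Unset Strict Implicit.
Unset Printing Implicit Defensive.

Import Order.TTheory GRing.Theory Num.Theory.

Local Open Scope classical_set_scope.
Local Open Scope ring_scope.

(** Every [f] has an expansion on the finite grid generated by the data points: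
    [f u] is the sum, over coordinate subsets [S] and cells of the grid on the
    face [S], of the quasi-volume of [f_S] on the cell times the indicator of
    [[w, 1]], where [w] is the upper corner of the cell extended by [0].  Each
    such indicator takes the values of a design column at the data; [S = set0]
    gives the unpenalized first column, and over the other [S] the absolute
    quasi-volumes sum to at most [V_HK0 f], so the data values of an admissible
    [f] are [A *m b] for a feasible [b].  Conversely the indicator of
    [[z, 1]] has HK0 variation [1] (only [S = supp z] contributes), or [0] when
    [z = 0], so feasible coefficients give admissible functions. *)

(** * Quasi-volumes of products of one-variable functions *)

(** The number of cells depends on the coordinate, so choosing one per coordinate is a dependent
    function. The terms are moved to the tagged union of the [T_ i], where ordinary distributivity
    applies. *)
Lemma prodr_sum_dffun (R : comPzSemiRingType) (I : finType) (T_ : I -> finType)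
    (F : forall i, T_ i -> R) :
  \prod_i \sum_(k : T_ i) F i k =
  \sum_(l : {dffun forall i, T_ i}) \prod_i F i (l i).
Proof.
under eq_bigr => i _ do rewrite (big_tag F).
rewrite bigA_distr_big_dep [RHS](reindex (@dffun_of_fprod _ _)); last first.
  exact/onW_bij/dffun_of_fprod_bij.
transitivity (\sum_(t : fprod T_) \prod_(i in I) [ffun k => F i k] (t i)).
  rewrite big_fprod; apply: eq_bigr => g /familyP gT; apply: eq_bigr => i _.
  by rewrite !(untagE _ _ (eqP (gT i))) ffunE.
by apply: eq_bigr => t _; apply: eq_bigr => i _; rewrite !ffunE.
Qed.

Lemma indic_box (R : realType) (I : finType) (a b u : I -> R) :
  \1_(box a b) u = \prod_i (a i <= u i <= b i)%R%:R :> R.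
Proof.
rewrite indicE; case: (pselect (box a b u)) => [uab|nuab].
  by rewrite mem_set// big1// => i _; rewrite uab.
rewrite memNset//; move/existsNP: nuab => [i /negP uabi].
by rewrite (bigD1 i)//= (negbTE uabi) mul0r.
Qed.

Lemma quasi_volumeZ (R : realType) (I : finType) (c : R)
    (f : (I -> R) -> R) (a b : I -> R) :
  quasi_volume (fun u => c * f u) a b = c * quasi_volume f a b.
Proof. by rewrite mulr_sumr; apply: eq_bigr => e _; rewrite mulrCA. Qed.

Lemma quasi_volume_sum (R : realType) (I J : finType)
    (f : J -> (I -> R) -> R) (a b : I -> R) :
  quasi_volume (fun u => \sum_j f j u) a b = \sum_j quasi_volume (f j) a b.
Proof. by rewrite exchange_big; apply: eq_bigr => e _; rewrite mulr_sumr. Qed.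

(** The signed sum over corners factors: in coordinate [i], index [0] selects [b i] and index [1]
    selects [a i] with a minus sign. On a degenerate side index [1] would be missing, hence the
    hypothesis. *)
Lemma quasi_volume_prod (R : realType) (I : finType) (h : I -> R -> R)
    (a b : I -> R) : (forall i, a i != b i) ->
  quasi_volume (fun u => \prod_i h i (u i)) a b =
  \prod_i (h i (b i) - h i (a i)).
Proof.
move=> ab.
pose F i (k : 'I_2) := (-1) ^+ k * h i (b i + k%:R * (a i - b i)).
transitivity (\prod_i \sum_k F i k); last first.
  apply: eq_bigr => i _; rewrite !big_ord_recl big_ord0 /F /= /bump /=.
  by rewrite expr0 !mul1r expr1 mul0r !addr0 mulN1r [b i + _]addrC subrK.
rewrite bigA_distr_bigA; apply: eq_big => [e|e _].
  by apply/forallP => i; rewrite ab/= -ltnS.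
by rewrite -prodrXr -big_split.
Qed.

Lemma restrict0_prod (R : realType) (I : finType) (S : {set I})
    (h : I -> R -> R) :
  restrict0 (S := S) (fun u => \prod_j h j (u j)) =
  fun u => (\prod_(j | j \notin S) h j 0) *
           \prod_(k : {j | j \in S}) h (val k) (u k).
Proof.
apply/funext => u; rewrite /restrict0 (bigID (mem S))/= mulrC; congr (_ * _).
  by apply: eq_bigr => j jS; rewrite /extend0 insubN.
rewrite big_sub; apply: eq_bigr => k _.
by rewrite /extend0 valK.
Qed.

Lemma itv_partition_cell (R : realType) (s : seq R) (a b : R) k :
  itv_partition a b s -> (k < size s)%N ->
  [/\ a <= nth 0 (a :: s) k, nth 0 (a :: s) k < nth 0 (a :: s) k.+1
    & nth 0 (a :: s) k.+1 <= b].
Proof.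
move=> sP ks.
have nthE m : (m <= size s)%N -> nth 0 (a :: s) m = nth b (a :: s) m.
  by move=> ms; apply: set_nth_default.
rewrite !nthE ?(ltnW ks)//; split.
- by apply: itv_partition_nth_ge => //; rewrite ltnS ltnW.
- case: sP => /(pathP b) sP _; exact: sP.
- exact: itv_partition_nth_le.
Qed.

Lemma cell_neq (R : realType) (I : finType) (P : I -> seq R)
    (l : {dffun forall s : I, 'I_(size (P s))}) :
  is_split P -> forall s, cell_lo l s != cell_hi l s.
Proof.
move=> Psplit s.
by have [_ /lt_eqF ->] := itv_partition_cell (Psplit s) (ltn_ord (l s)).
Qed.

Lemma quasi_volume_restrict0_prod (R : realType) (I : finType) (S : {set I})
    (h : I -> R -> R) (P : {j | j \in S} -> seq R)
    (l : {dffun forall s, 'I_(size (P s))}) : is_split P ->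
  quasi_volume (restrict0 (fun u => \prod_j h j (u j))) (cell_lo l) (cell_hi l) =
  (\prod_(j | j \notin S) h j 0) *
  \prod_(k : {j | j \in S}) (h (val k) (cell_hi l k) - h (val k) (cell_lo l k)).
Proof.
move=> Psplit; rewrite restrict0_prod quasi_volumeZ.
by rewrite (quasi_volume_prod (fun k : {j | j \in S} => h (val k)))//; exact: cell_neq.
Qed.

(** * Variation of combinations of indicators *)

Lemma split_variation_indic (R : realType) (I : finType) (S : {set I})
    (z : I -> R) (P : {j | j \in S} -> seq R) :
  cube R I z -> is_split P ->
  split_variation (restrict0 (S := S) \1_(box z 1)) P =
  (S == [set j | z j != 0]%SET)%:R.
Proof.
move=> zc Psplit.
pose h j (t : R) : R := (z j <= t <= 1)%R%:R.
have -> : \1_(box z 1) = fun u => \prod_j h j (u j).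
  by apply/funext => u; rewrite indic_box.
have h0 j : h j 0 = (z j == 0)%:R.
  by rewrite /h ler01 andbT eq_le (andP (zc j)).1 andbT.
have h1 j : h j 1 = 1 by rewrite /h lexx andbT (andP (zc j)).2.
(* The step falls back to [0] beyond [1], hence the bound on [t]. *)
have hmono j s t : s <= t -> t <= 1 -> h j s <= h j t.
  move=> st t1; rewrite /h t1 (le_trans st t1) !andbT ler_nat.
  by case: (z j <= s) / idP => // zs; rewrite (le_trans zs st).
transitivity ((\prod_(j | j \notin S) h j 0) *
   \prod_(k : {j | j \in S}) (1 - h (val k) 0)); last first.
  rewrite -(big_sub (mem S) (fun j => 1 - h j 0)).
  have [->|] := eqVneq S [set j | z j != 0]%SET.
    rewrite !big1 ?mulr1// => j; rewrite inE ?negbK h0.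
      by move=> /negbTE ->; rewrite subr0.
    by move=> ->.
  move=> /eqP/setP/existsNP[j] /eqP; rewrite inE => jS.
  case: (boolP (j \in S)) jS => jS /=; rewrite eq_sym ?eqb_id ?eqbF_neg ?negbK => zj.
  - rewrite [X in _ * X](bigD1 j)//= h0.
    by move: zj; case: eqP => // _ _; rewrite subrr mul0r mulr0.
  - rewrite (bigD1 j)//= h0.
    by move: zj; case: eqP => // _ _; rewrite !mul0r.
pose D (k : {j | j \in S}) (m : nat) :=
  h (val k) (nth 0 (0 :: P k) m.+1) - h (val k) (nth 0 (0 :: P k) m).
transitivity (\sum_(l : {dffun forall s, 'I_(size (P s))})
    (\prod_(j | j \notin S) h j 0) * \prod_k D k (l k)).
  apply: eq_bigr => l _.
  rewrite (quasi_volume_restrict0_prod h l Psplit) ger0_norm//.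
  rewrite mulr_ge0// prodr_ge0// => k _; rewrite subr_ge0.
  have [_ /ltW] := itv_partition_cell (Psplit k) (ltn_ord (l k)).
  exact: hmono.
rewrite -mulr_sumr; congr (_ * _).
rewrite -(prodr_sum_dffun (fun k (m : 'I_(size (P k))) => D k m)).
apply: eq_bigr => k _.
rewrite -(big_mkord xpredT (D k)).
rewrite (telescope_sumr (fun m => h (val k) (nth 0 (0 :: P k) m)))//.
by rewrite (itv_partition_nth_size _ (Psplit k)) h1.
Qed.

Lemma split_variation_sum_le (R : realType) (I J : finType) (c : J -> R)
    (f : J -> (I -> R) -> R) (P : I -> seq R) :
  split_variation (fun u => \sum_j c j * f j u) P <=
  \sum_j `|c j| * split_variation (f j) P.
Proof.
under [leRHS]eq_bigr => j _ do rewrite mulr_sumr.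
rewrite exchange_big; apply: ler_sum => l _ /=.
rewrite quasi_volume_sum (le_trans (ler_norm_sum _ _ _))//.
by apply: ler_sum => j _; rewrite quasi_volumeZ normrM.
Qed.

(** By the triangle inequality, the term [j] costs at most [|c j|], paid only at the face [S] equal
    to the support of [z j]; an empty support costs nothing. *)
Lemma HK0_variation_sum_indic (R : realType) (d : nat) (J : finType)
    (c : J -> R) (z : J -> 'I_d -> R) : (forall j, cube R 'I_d (z j)) ->
  (HK0_variation (fun u => \sum_j c j * \1_(box (z j) 1) u)%R <=
   (\sum_(j | `[< z j <> 0%R >]) `|c j|)%R%:E)%E.
Proof.
move=> zc; pose supp j : {set 'I_d} := [set i | z j i != 0]%SET.
have supp0 j : (supp j != finset.set0) = `[< z j <> 0 >].
  apply/idP/asboolP => [|zj].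
    by apply: contra_neq_not => zj; apply/setP => i; rewrite !inE zj eqxx.
  apply/eqP => /setP s0; apply: zj; apply/funext => i.
  by have := s0 i; rewrite !inE => /negbFE/eqP.
apply: (@le_trans _ _ (\sum_(S : {set 'I_d} | S != finset.set0)
    (\sum_j `|c j| * (S == supp j)%:R)%R%:E)%E); last first.
  rewrite sumEFin lee_fin exchange_big [leRHS]big_mkcond/=.
  apply: ler_sum => j _; rewrite -mulr_sumr -supp0.
  case: ifPn => s0.
    by rewrite (bigD1 (supp j))//= eqxx big1 ?addr0 ?mulr1// => S /andP[_ /negbTE ->].
  rewrite big1 ?mulr0// => S; apply: contraNeq.
  by rewrite pnatr_eq0 eqb0 negbK => /eqP ->; exact: negbNE s0.
apply: lee_sum => S _; apply: ge_ereal_sup => _ [P Psplit <-].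
rewrite lee_fin (le_trans (split_variation_sum_le c
  (fun j => restrict0 (S := S) \1_(box (z j) 1)) P))//.
by apply: ler_sum => j _; rewrite split_variation_indic.
Qed.

(** * Expansion of a function on a finite grid *)

(** The interior points are sorted without repetition and [1] is appended; a point equal to [0] is
    the head of [0 :: L]. *)
Lemma itv_partition_through (R : realType) (s : seq R) :
  (forall t, t \in s -> 0 <= t <= 1) ->
  exists2 L, itv_partition (0 : R) 1 L & {subset s <= 0 :: L}.
Proof.
move=> s01; pose s' := sort <=%O (undup [seq t <- s | 0 < t < 1]).
have s'E t : t \in s' = (0 < t < 1) && (t \in s).
  by rewrite mem_sort mem_undup mem_filter.
exists (rcons s' 1) => [|t ts].
  split; last by rewrite last_rcons.
  rewrite rcons_path; apply/andP; split.
    rewrite path_sortedE; last exact: lt_trans.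
    rewrite sort_lt_sorted undup_uniq andbT.
    by apply/allP => t; rewrite s'E => /andP[/andP[]].
  have := mem_last 0 s'; rewrite inE => /predU1P[->//|].
  by rewrite s'E => /andP[/andP[]].
rewrite inE mem_rcons inE s'E ts andbT.
have /andP[] := s01 t ts; rewrite !le_eqVlt eq_sym.
by case: eqP => //= _ ->; case: eqP.
Qed.

Lemma sum_increments (R : realType) (L : seq R) (h : R -> R) (t : R) :
  itv_partition 0 1 L -> t \in 0 :: L ->
  h t = h 0 + \sum_(m < size L)
    (h (nth 0 (0 :: L) m.+1) - h (nth 0 (0 :: L) m)) *
    (nth 0 (0 :: L) m.+1 <= t <= 1)%R%:R.
Proof.
move=> LP /(nthP 0)[k kL <-].
have sL : sorted <%O (0 :: L) by case: LP.
have k1 : nth 0 (0 :: L) k <= 1.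
  rewrite (set_nth_default 1)//; exact: itv_partition_nth_le.
pose D m := h (nth 0 (0 :: L) m.+1) - h (nth 0 (0 :: L) m).
transitivity (h 0 + \sum_(0 <= m < k) D m).
  by rewrite (telescope_sumr (fun m => h (nth 0 (0 :: L) m)))//= addrC subrK.
(* With [t] the [k]-th grid point, [m < k] says that the upper end [m.+1] of the increment is at
   most [k], which by strict sortedness is what the indicator tests. *)
congr (_ + _); rewrite (big_nat_widen _ _ (size L))//= big_mkcond big_mkord.
apply: eq_bigr => m _; rewrite k1 andbT -[L`_m]/(nth 0 (0 :: L) m.+1).
rewrite (lt_sorted_leq_nth 0 sL) ?inE ?ltnS//.
by case: ifP; rewrite (mulr1, mulr0).
Qed.

(** Only corner values enter; this allows replacing [f] by a function that agrees with it on the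
    grid alone. *)
Lemma eq_quasi_volume (R : realType) (I : finType) (f g : (I -> R) -> R)
    (a b : I -> R) :
  (forall u, (forall i, u i = a i \/ u i = b i) -> f u = g u) ->
  quasi_volume f a b = quasi_volume g a b.
Proof.
move=> fg; apply: eq_bigr => e _; congr (_ * _); apply: fg => i.
case: (e i) => [[|[|//]]] /= _; first by right; rewrite mul0r addr0.
by left; rewrite mul1r addrC subrK.
Qed.

(** Each factor is [h j 0] plus a sum of increments. Multiplying out, [S] collects the coordinates
    where the increments are chosen, and each choice of increments is a cell of the face [S]. *)
Lemma HK0_expansion_prod (R : realType) (I : finType) (h : I -> R -> R)
    (P : I -> seq R) (u : I -> R) :
  is_split P -> (forall j, u j \in 0 :: P j) ->
  \prod_j h j (u j) =
  \sum_(S : {set I})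
    \sum_(l : {dffun forall k : {j | j \in S}, 'I_(size (P (val k)))})
      quasi_volume (restrict0 (S := S) (fun u => \prod_j h j (u j)))
        (cell_lo (P := P \o val) l) (cell_hi (P := P \o val) l) *
      \1_(box (extend0 (cell_hi (P := P \o val) l)) 1) u.
Proof.
move=> Psplit uP.
pose D j (m : nat) := (h j (nth 0 (0 :: P j) m.+1) - h j (nth 0 (0 :: P j) m)) *
    (nth 0 (0 :: P j) m.+1 <= u j <= 1)%R%:R.
have u01 j : 0 <= u j <= 1.
  have /(nthP 0)[k kL <-] := uP j; rewrite (set_nth_default 1)//.
  by rewrite itv_partition_nth_le ?itv_partition_nth_ge.
under eq_bigr => j _ do rewrite (sum_increments (h j) (Psplit j) (uP j)) addrC.
rewrite bigA_distr; apply: eq_bigr => S _.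
rewrite (bigID (mem S))/= mulrC.
under eq_bigr => j /negbTE -> do [].
under [X in _ * X]eq_bigr => j -> do [].
rewrite (big_sub (mem S) (fun j => \sum_(m < size (P j)) D j m)).
rewrite (prodr_sum_dffun (fun (k : {j | j \in S}) (m : 'I_(size (P (val k)))) =>
  D (val k) m)) mulr_sumr.
apply: eq_bigr => l _.
rewrite quasi_volume_restrict0_prod; last by move=> k; exact: Psplit.
rewrite indic_box -mulrA; congr (_ * _).
(* Outside [S] the extended corner is [0], so the indicator factor is [1] there. *)
rewrite [X in _ = _ * X](bigID (mem S))/= [X in _ = _ * (_ * X)]big1 => [|j jS].
  rewrite mulr1 [X in _ = _ * X]big_sub -big_split; apply: eq_bigr => k _ /=.
  by rewrite /extend0 valK.
by rewrite /extend0 insubN// u01.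
Qed.

(* On the finite grid of split points, [f] is a linear combination of products
   of one-variable delta functions, and both sides are linear in [f]. *)
Lemma HK0_expansion (R : realType) (I : finType) (f : (I -> R) -> R)
    (P : I -> seq R) (u : I -> R) :
  is_split P -> (forall j, u j \in 0 :: P j) ->
  f u =
  \sum_(S : {set I})
    \sum_(l : {dffun forall k : {j | j \in S}, 'I_(size (P (val k)))})
      quasi_volume (restrict0 (S := S) f)
        (cell_lo (P := P \o val) l) (cell_hi (P := P \o val) l) *
      \1_(box (extend0 (cell_hi (P := P \o val) l)) 1) u.
Proof.
move=> Psplit uP.
(* A partition with [size (P j)] cells has one more point, the initial [0]. *)
pose pt (w : {dffun forall j, 'I_(size (P j)).+1}) j := nth 0 (0 :: P j) (w j).
pose g (v : I -> R) := \sum_w f (pt w) * \prod_j (v j == pt w j)%:R.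
have fg v : (forall j, v j \in 0 :: P j) -> f v = g v.
  move=> vP; have iv j : (index (v j) (0%R :: P j) < (size (P j)).+1)%N.
    by have := vP j; rewrite -index_mem.
  pose w0 : {dffun forall j, 'I_(size (P j)).+1} := [ffun j => Ordinal (iv j)].
  have w0E : pt w0 = v.
    by apply/funext => j; rewrite /pt ffunE /= -[RHS](nth_index 0 (vP j)).
  rewrite /g (bigD1 w0)//= w0E big1 ?mulr1 => [|j _]; last by rewrite eqxx.
  rewrite big1 ?addr0// => w ww0.
  have [j vw] : exists j, v j != pt w j.
    apply/existsP; apply: contraNT ww0; rewrite negb_exists => /forallP vw.
    apply/eqP/ffunP => j; apply/val_inj/eqP; rewrite eq_sym.
    have := vw j; rewrite negbK -[v]w0E /pt nth_uniq//.
    by apply: lt_sorted_uniq; case: (Psplit j).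
  by rewrite (bigD1 j)//= (negbTE vw) mul0r mulr0.
rewrite fg// /g; under eq_bigr => w _.
  rewrite (HK0_expansion_prod (fun j t => (t == pt w j)%:R) Psplit uP).
  rewrite mulr_sumr; under eq_bigr => S _ do rewrite mulr_sumr.
  over.
rewrite exchange_big; apply: eq_bigr => S _ /=.
rewrite exchange_big; apply: eq_bigr => l _ /=.
(* Corners of cells, extended by [0], are grid points, where [f] and [g] agree. *)
rewrite (@eq_quasi_volume _ _ _ (restrict0 (S := S) g)) => [|v vl].
  rewrite quasi_volume_sum mulr_suml; apply: eq_bigr => w _.
  by rewrite (quasi_volumeZ (f (pt w))) mulrA.
apply: fg => j; rewrite /extend0.
case: insubP => [k _ <-|_]; last exact: mem_head.
have kl := ltn_ord (l k).
by case: (vl k) => ->; apply: mem_nth => //; exact: ltnW.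
Qed.

(** * From admissible functions to feasible coefficients, and conclusion *)

Lemma sum_select (R : pzSemiRingType) (J : finType) (T : eqType) (phi : J -> T)
    (F : J -> R) (i : J) :
  injective phi -> \sum_j F j * (phi j == phi i)%:R = F i.
Proof.
move=> phi_inj; rewrite (bigD1 i)//= eqxx mulr1 big1 ?addr0// => j ji.
by rewrite (inj_eq phi_inj) (negbTE ji) mulr0.
Qed.

Lemma HK0_design_coefficients (R : realType) (d n p : nat) (V : R)
    (x : 'I_n -> 'I_d -> R) (A : 'M[R]_(n, p.+1)) (z : 'I_p.+1 -> 'I_d -> R)
    (f : ('I_d -> R) -> R) :
  (forall i, cube R 'I_d (x i)) -> is_design x A z ->
  (HK0_variation f <= V%:E)%E ->
  exists2 b : 'cV[R]_p.+1, \sum_(j | j != ord0) `|b j ord0| <= V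
    & forall i, (A *m b) i ord0 = f (x i).
Proof.
move=> xc [[_ col_inj col_surj] col0 _ _ _ _] fV.
have [P Psplit xP] : exists2 P, is_split P & forall i j, x i j \in 0 :: P j.
  have /choice[P PP] (j : 'I_d) : exists L, itv_partition (0 : R) 1 L /\
      {subset [seq x i j | i : 'I_n] <= 0 :: L}.
    have [_ /mapP[i _ ->]|L LP sL] := @itv_partition_through R [seq x i j | i : 'I_n].
      exact: xc.
    by exists L.
  exists P => [j|i j]; first exact: (PP j).1.
  by apply: (PP j).2; apply: map_f; rewrite mem_enum.
pose cell (S : {set 'I_d}) :=
  {dffun forall k : {j | j \in S}, 'I_(size (P (val k)))}.
pose lo S (l : cell S) := cell_lo (P := P \o val) l.
pose hi S (l : cell S) := cell_hi (P := P \o val) l.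
pose c S (l : cell S) := quasi_volume (restrict0 f) (lo S l) (hi S l).
pose q S (l : cell S) := design_col x (extend0 (hi S l)).
have A_inj : injective (fun j => col j A).
  by move=> j k; apply: col_inj; rewrite inE.
(* The extended upper corner lies in the cube, so its column occurs in [A]. *)
have qA S l : exists j, q S l = col j A.
  have [|j _ <-] := col_surj (q S l); last by exists j.
  exists (extend0 (hi S l)) => // j; rewrite /extend0.
  case: insubP => [k _ _|_]; last by rewrite lexx ler01.
  have [l0 lh ->] := itv_partition_cell (Psplit (val k)) (ltn_ord (l k)).
  by rewrite andbT (le_trans l0 (ltW lh)).
have q0 l : q finset.set0 l = col ord0 A.
  rewrite col0; congr design_col; apply/funext => j.
  by rewrite /extend0 insubN// inE.
(* The coefficient of a column collects the quasi-volumes of all cells, over all faces, whose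
   indicator takes that column as its data values. *)
exists (\col_j \sum_S \sum_(l : cell S) c S l * (col j A == q S l)%:R); last first.
  move=> i; rewrite (HK0_expansion f Psplit (xP i)) mxE.
  under eq_bigr => j _.
    rewrite mxE mulr_sumr; under eq_bigr => S _ do rewrite mulr_sumr.
    over.
  rewrite exchange_big; apply: eq_bigr => S _ /=.
  rewrite exchange_big; apply: eq_bigr => l _ /=.
  under eq_bigr => j _ do rewrite mulrCA.
  rewrite -mulr_sumr; congr (_ * _).
  have [k qk] := qA S l; rewrite qk (sum_select (A i))//.
  by have /colP/(_ i) := qk; rewrite !mxE.
(* Each cell feeds exactly one column, so it is penalized once, or not at all if that column is the
   first. *)
have q_count S l : \sum_(j | j != ord0) (col j A == q S l)%:R =
    (q S l != col ord0 A)%:R :> R.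
  have [k ->] := qA S l; rewrite (inj_eq A_inj) big_mkcond/=.
  rewrite -(sum_select (fun j => (j != ord0)%:R) k A_inj).
  by apply: eq_bigr => j _; case: ifP; rewrite (mul1r, mul0r).
apply: (@le_trans _ _ (\sum_(S | S != finset.set0)
    split_variation (restrict0 (S := S) f) (P \o val))).
  (* All cells of [set0] have weight [0] here; on the other faces the weight is merely bounded by
     [1], since a nonzero corner may also give the first column. *)
  apply: (@le_trans _ _ (\sum_S \sum_(l : cell S) `|c S l| *
      (q S l != col ord0 A)%:R)).
    under [leRHS]eq_bigr => S _ do
      (under eq_bigr => l _ do rewrite -q_count mulr_sumr; rewrite exchange_big).
    rewrite exchange_big; apply: ler_sum => j _ /=; rewrite mxE.
    rewrite (le_trans (ler_norm_sum _ _ _))//; apply: ler_sum => S _.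
    rewrite (le_trans (ler_norm_sum _ _ _))//; apply: ler_sum => l _.
    by rewrite normrM normr_nat.
  rewrite (bigD1 finset.set0)//= big1 ?add0r => [|l _].
    apply: ler_sum => S _; apply: ler_sum => l _.
    by rewrite ler_piMr// lern1 leq_b1.
  by rewrite q0 eqxx mulr0.
rewrite -lee_fin -sumEFin (le_trans _ fV)//; apply: lee_sum => S _.
by apply: ereal_sup_ubound; exists (P \o val) => // k; exact: Psplit.
Qed.

Theorem proposition3p3 (R : realType) (d n p : nat) (V : R)
    (x : 'I_n -> 'I_d -> R) (y : 'cV[R]_n)
    (A : 'M[R]_(n, p.+1)) (z : 'I_p.+1 -> 'I_d -> R) (beta : 'cV[R]_p.+1) :
  (1 <= d)%N -> (1 <= n)%N -> 0 < V ->
  (forall i, cube R 'I_d (x i)) ->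
  is_design x A z ->
  is_argmin [set b : 'cV[R]_p.+1 | \sum_(j | j != ord0) `|b j ord0| <= V]
    (fun b => euclidean_norm (y - A *m b) ^+ 2) beta ->
  is_argmin [set f : ('I_d -> R) -> R | (HK0_variation f <= V%:E)%E]
    (fun f => n%:R^-1 * \sum_i (y i ord0 - f (x i)) ^+ 2)
    (fun u => \sum_j beta j ord0 * \1_(box (z j) 1) u).
Proof.
move=> _ _ _ xc Ades [beta_feas beta_min].
have [_ _ zc _ z0 colz] := Ades.
have fit i : (A *m beta) i ord0 = \sum_j beta j ord0 * \1_(box (z j) 1) (x i).
  rewrite mxE; apply: eq_bigr => j _; rewrite mulrC; congr (_ * _).
  by have /colP/(_ i) := colz j; rewrite !mxE.
have norm2 b : euclidean_norm (y - A *m b) ^+ 2 =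
    \sum_i (y i ord0 - (A *m b) i ord0) ^+ 2.
  rewrite sqr_sqrtr; last by rewrite sumr_ge0// => i _; exact: sqr_ge0.
  by apply: eq_bigr => i _; rewrite !mxE.
split=> [|f fV] /=.
  apply: (le_trans (HK0_variation_sum_indic _ zc)); rewrite lee_fin.
  (* Since [z ord0 = 0], every index with [z j <> 0] is penalized. *)
  apply: (le_trans _ beta_feas); rewrite big_mkcond [leRHS]big_mkcond.
  apply: ler_sum => j _; case: asboolP => [zj|_]; last by case: ifP.
  by case: eqP => // j0; case: zj; rewrite j0.
(* The competitor [f] has the data values of a feasible [b], so both objectives are rescaled LASSO
   objectives. *)
have [b bV bf] := HK0_design_coefficients xc Ades fV.
rewrite ler_wpM2l ?invr_ge0//.
under eq_bigr => i _ do rewrite -fit.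
under [leRHS]eq_bigr => i _ do rewrite -bf.
by rewrite -!norm2; exact: beta_min.
Qed.
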